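(* Let $d,J\ge 1$ be integers, $r\ge 1$, and let $\nu_1,\ldots,\nu_J,\nu'_1,\ldots,\nu'_J\in\mathcal{W}_r(\mathbb{R}^d)$. Let $n_1,\ldots,n_J\ge 1$. For each $j$, let $Y_{1,j},\ldots,Y_{n_j,j}$ be iid with law $\nu_j$, the $J$ samples being independent, and let $\nu_{n_j,j}$ be the empirical measure of the $j$th sample. Likewise, for each $j$, let $Y'_{1,j},\ldots,Y'_{n_j,j}$ be iid with law $\nu'_j$, the $J$ samples being independent, with empirical measures $\nu'_{n_j,j}$. Then $$W_r^r\big[\mathcal{L}\{V_r(\nu_{n_1,1},\ldots,\nu_{n_J,J})\},\,\mathcal{L}\{V_r(\nu'_{n_1,1},\ldots,\nu'_{n_J,J})\}\big]\le\frac1J\sum_{j=1}^J W_r^r(\nu_j,\nu'_j).$$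
   Context: $\mathcal{W}_r(\mathbb{R}^d)$ is the set of Borel probability measures on $\mathbb{R}^d$ with finite $r$th moment. $W_r(\mu,\nu)$ is the Wasserstein distance, $W_r(\mu,\nu)^r=\inf_{\pi\in\Pi(\mu,\nu)}\int\|x-y\|^r\,d\pi(x,y)$, where $\Pi(\mu,\nu)$ is the set of probability measures on $\mathbb{R}^d\times\mathbb{R}^d$ with marginals $\mu$ and $\nu$; $W_r^r$ means $(W_r)^r$. The Wasserstein $r$-variation of $\mu_1,\ldots,\mu_J\in\mathcal{W}_r(\mathbb{R}^d)$ is $$V_r(\mu_1,\ldots,\mu_J)=\inf_{\eta\in\mathcal{W}_r(\mathbb{R}^d)}\Big\{\frac1J\sum_{j=1}^J W_r^r(\mu_j,\eta)\Big\}^{1/r}.$$ $\mathcal{L}(Z)$ denotes the law of a random variable $Z$. The symbol $W_r$ is used both on $\mathbb{R}^d$ and on $\mathbb{R}$; on the left-hand side it is the distance between laws on $\mathbb{R}$ of real random variables. *)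

(* Defs.v *)
From HB Require Import structures.
From mathcomp Require Import all_boot all_order all_algebra.
From mathcomp Require Import all_classical all_reals all_analysis.

Set Implicit Arguments.
Unset Strict Implicit.
Unset Printing Implicit Defensive.

Import Order.TTheory GRing.Theory Num.Theory.
Import numFieldNormedType.Exports.

Local Open Scope classical_set_scope.
Local Open Scope ring_scope.
Local Open Scope ereal_scope.

(* The topology of 'rV[R]_d is the product topology, i.e. the usual one. *)
Definition borel_rV (R : realType) (d : nat) :=
  g_sigma_algebraType (@open 'rV[R]_d).

(* The library norm on row vectors is the sup norm, hence a separate one. *)
Definition euclidean_norm (R : realType) (d : nat) (x : 'rV[R]_d) : R :=
  Num.sqrt (\sum_(i < d) (x 0%R i) ^+ 2)%R.

Definition euclidean_dist (R : realType) (d : nat) (x y : borel_rV R d) : R :=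
  euclidean_norm ((x : 'rV[R]_d) - (y : 'rV[R]_d))%R.

Definition abs_dist (R : realType) (x y : measurableTypeR R) : R :=
  `|(x : R) - (y : R)|%R.

Section wasserstein.
Context (disp : measure_display) (T : measurableType disp) (R : realType).
Implicit Types mu nu : {measure set T -> \bar R}.

(* T * T carries the product sigma-algebra, which for R^d and R is the Borel
   sigma-algebra of the product.  As pi is a probability, measures mu and nu
   that are not of mass 1 have no coupling. *)
Definition couplings mu nu : set (probability (T * T)%type R) :=
  [set pi | forall A : set T, measurable A ->
     pi (A `*` setT) = mu A /\ pi (setT `*` A) = nu A].

Definition wasserstein (dist : T -> T -> R) (r : R) mu nu : \bar R :=
  ereal_inf [set \int[pi]_z ((dist z.1 z.2) `^ r)%:E | pi in couplings mu nu]
    `^ r^-1.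

End wasserstein.

Definition finite_moment (R : realType) (d : nat) (r : R)
    (mu : probability (borel_rV R d) R) : Prop :=
  \int[mu]_x ((euclidean_norm (x : 'rV[R]_d)) `^ r)%:E < +oo.

Definition wasserstein_variation (R : realType) (d J : nat) (r : R)
    (mu : 'I_J -> {measure set (borel_rV R d) -> \bar R}) : \bar R :=
  ereal_inf
    [set ((J%:R^-1)%:E *
          \sum_(j < J) wasserstein (@euclidean_dist R d) r (mu j) eta `^ r)
         `^ r^-1
    | eta in [set eta : probability (borel_rV R d) R | finite_moment r eta]].

Section empirical.
Context (disp : measure_display) (T : measurableType disp) (R : realType).
Variables (n : nat) (y : 'I_n -> T).

Definition empirical (A : set T) : \bar R :=
  (n%:R^-1)%:E * \sum_(i < n) \d_(y i) A.

Let empirical0 : empirical set0 = 0.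
Proof. by rewrite /empirical big1 ?mule0// => i _; rewrite measure0. Qed.

Let empirical_ge0 A : 0 <= empirical A.
Proof. by rewrite mule_ge0// ?lee_fin ?invr_ge0// sume_ge0. Qed.

Let empirical_sigma_additive : semi_sigma_additive empirical.
Proof.
move=> F mF tF mUF.
rewrite [X in X @ \oo --> _](_ : _ = (fun k => (n%:R^-1)%:E *
    \sum_(i < n) \sum_(0 <= l < k) \d_(y i) (F l))); last first.
  apply/funext => k; rewrite exchange_big/= ge0_sume_distrr//.
  by move=> i _; exact: sume_ge0.
apply: cvgeZl => //.
apply: cvg_nnesum => [i _|i _].
  by near=> k; exact: sume_ge0.
exact: measure_semi_sigma_additive.
Unshelve. all: by end_near. Qed.

HB.instance Definition _ := isMeasure.Build _ _ _ empirical
  empirical0 empirical_ge0 empirical_sigma_additive.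

Lemma empirical_setT : (0 < n)%N -> empirical setT = 1.
Proof.
move=> n0; rewrite /empirical (eq_bigr (fun=> 1%:E)); last first.
  by move=> i _; rewrite diracT.
rewrite sumEFin sumr_const card_ord -EFinM mulVf//.
by rewrite pnatr_eq0 -lt0n.
Qed.

End empirical.

Definition mutually_independent (disp disp' : measure_display)
    (Omega : measurableType disp) (T : measurableType disp') (R : realType)
    (P : probability Omega R) (I : finType) (X : I -> {RV P >-> T}) : Prop :=
  forall (S : {set I}) (B : I -> set T), (forall i, measurable (B i)) ->
    P (\bigcap_(i in [set` S]) (X i @^-1` B i)) =
    \prod_(i in S) P (X i @^-1` B i).

(* Agreement is required on measurable sets only, since the value of a
   library measure on other sets is arbitrary. *)
Definition has_law (disp disp' : measure_display)
    (Omega : measurableType disp) (T : measurableType disp') (R : realType)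
    (P : probability Omega R) (X : {RV P >-> T})
    (nu : probability T R) : Prop :=
  forall A : set T, measurable A -> distribution P X A = nu A.

(* J independent samples, the j-th being iid with law nu j: all the variables
   Y j i, indexed by pairs (j, i), are mutually independent. *)
Definition independent_samples (disp disp' : measure_display)
    (Omega : measurableType disp) (T : measurableType disp') (R : realType)
    (P : probability Omega R) (J : nat) (n : 'I_J -> nat)
    (nu : 'I_J -> probability T R)
    (Y : forall j : 'I_J, 'I_(n j) -> {RV P >-> T}) : Prop :=
  (forall j i, has_law (Y j i) (nu j)) /\
  mutually_independent
    (fun k : {j : 'I_J & 'I_(n j)} => Y (tag k) (tagged k)).

(* Main.v *)
(* V_r of the empirical measures is a function G of the points, and G is
   Lipschitz with constant 1 for
   D(y, y') = (1/J sum_j 1/n_j sum_i |y_ij - y'_ij|^r)^(1/r): a coupling of the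
   empirical measure of y' with eta is turned into one of the empirical measure
   of y with eta by moving each atom y'_i to y_i.  Given couplings pi_j of nu_j
   and nu'_j, draw all the pairs (Y_ij, Y'_ij) independently with law pi_j; then
   (G(Y), G(Y')) couples the two laws of V_r and its cost is at most
   E D(Y, Y')^r = 1/J sum_j int |x - y|^r dpi_j.  Optimise over the pi_j. *)
Require Import Defs.
From HB Require Import structures.
From mathcomp Require Import all_boot all_order all_algebra.
From mathcomp Require Import all_classical all_reals all_analysis.
From mathcomp Require Import measurable_realfun.
From mathcomp Require Import ring lra.

Set Implicit Arguments.
Unset Strict Implicit.
Unset Printing Implicit Defensive.

Import Order.TTheory GRing.Theory Num.Theory.
Import numFieldNormedType.Exports.

Local Open Scope classical_set_scope.
Local Open Scope ring_scope.
Local Open Scope ereal_scope.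

(** The atoms can be moved without disintegration, because the measure on that side is finitely
    supported: restricting a coupling to the slice above an atom replaces conditioning. That V_r of
    a sample is a real number comes from the Lipschitz bound itself, by comparison with the sample
    that has all its points at the origin. The new pairs live on another probability space than the
    given samples; the variations they produce have the right laws because G is measurable for the
    product sigma-algebra on families of points, and a law there is determined by its values on
    boxes. *)

(** * Weighted inequalities for r-th powers *)

(* This and its converse powR_weighted_addl replace Minkowski's inequality: the
   weighted bound is linear in the r-th powers, so that it passes to integrals,
   sums and infima, and t is optimised only at the end. *)
Lemma powR_addl_weighted (R : realType) (r a b t : R) : (1 <= r)%R ->
  (0 <= a)%R -> (0 <= b)%R -> (0 < t < 1)%R ->
  ((a + b) `^ r <= t `^ (1 - r) * a `^ r + (1 - t) `^ (1 - r) * b `^ r)%R.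
Proof.
move=> r1 a0 b0 /andP[t0 t1].
have s0 : (0 < 1 - t)%R by rewrite subr_gt0.
have in0y (x c : R) : (0 <= x)%R -> (0 < c)%R ->
    (x / c)%R \in (`[0%R, +oo[%classic : set R).
  by move=> x0 c0; rewrite inE/= in_itv/= andbT divr_ge0// ltW.
(* Convexity of the r-th power at the points [a / t] and [b / (1 - t)], with weights [t] and
   [1 - t]; [E] below collects the powers of the weights. *)
have := convex_powR r1 (Itv01 (ltW t0) (ltW t1)) (in0y _ _ a0 t0) (in0y _ _ b0 s0).
rewrite [X in (powR X r <= _)%R -> _]convRE /= -/(1 - t)%R.
rewrite ![in X in (X <= _)%R -> _]mulrA ![(_ * _ / _)%R]mulrAC !mulfV ?gt_eqF// !mul1r.
have E (x c : R) : (0 <= x)%R -> (0 < c)%R ->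
    (c * (x / c) `^ r = c `^ (1 - r) * x `^ r)%R.
  move=> x0 c0; rewrite powRM ?invr_ge0 ?(ltW c0)//.
  rewrite -powR_inv1 ?(ltW c0)// -powRrM mulN1r mulrCA mulrC; congr (_ * _)%R.
  rewrite powRD ?(gt_eqF c0) ?implybT//.
  by rewrite powRr1// ltW.
by rewrite [in X in X -> _]convRE /= -/(1 - t)%R !E.
Qed.

Lemma powR_weighted_addl (R : realType) (r h a b : R) : (1 <= r)%R ->
  (0 <= h)%R -> (0 <= a)%R -> (0 <= b)%R ->
  (forall t, (0 < t < 1)%R ->
    (h <= t `^ (1 - r) * a `^ r + (1 - t) `^ (1 - r) * b `^ r)%R) ->
  (h `^ r^-1 <= a + b)%R.
Proof.
move=> r1 h0 a0 b0 H; apply/ler_addgt0Pr => e e0.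
have r0 : (0 < r)%R by exact: lt_le_trans r1.
(* The optimal t is a / (a + b); adding e / 2 keeps it inside ]0, 1[. *)
pose a' := (a + e / 2)%R; pose b' := (b + e / 2)%R.
have a'0 : (0 < a')%R by rewrite ltr_wpDl// divr_gt0.
have b'0 : (0 < b')%R by rewrite ltr_wpDl// divr_gt0.
have ab0 : (0 < a' + b')%R by rewrite addr_gt0.
have -> : (a + b + e = a' + b')%R by rewrite /a' /b'; lra.
have eq1 : (1 - a' / (a' + b') = b' / (a' + b'))%R.
  by field; rewrite gt_eqF.
have := H (a' / (a' + b'))%R; rewrite eq1 divr_gt0//= ltr_pdivrMr// mul1r ltrDl b'0.
move=> /(_ isT) le_h.
set s := (a' + b')%R in le_h ab0 *.
(* At the weight [x / s] a term is exactly the share [x / s] of the r-th power of [s], and the two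
   shares add up to 1. *)
have E (x : R) : (0 < x)%R -> ((x / s) `^ (1 - r) * x `^ r = x / s * s `^ r)%R.
  move=> x0; have u0 : (0 < x / s)%R by rewrite divr_gt0.
  have -> : (x `^ r = (x / s) `^ r * s `^ r)%R.
    by rewrite -powRM ?(ltW u0) ?(ltW ab0)// divfK ?gt_eqF.
  rewrite mulrA -powRD subrK ?oner_eq0//.
  by rewrite powRr1// ltW.
have {}le_h : (h <= s `^ r)%R.
  apply: (le_trans le_h).
  rewrite [leRHS](_ : _ = (a' / s * s `^ r + b' / s * s `^ r)%R); last first.
    by rewrite -mulrDl -mulrDl mulfV ?mul1r// gt_eqF.
  rewrite -!E//; apply: lerD; apply: ler_wpM2l; rewrite ?powR_ge0//.
    by apply: ge0_ler_powR; rewrite ?nnegrE ?(ltW r0) ?(ltW a'0)// lerDl divr_ge0// ltW.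
  by apply: ge0_ler_powR; rewrite ?nnegrE ?(ltW r0) ?(ltW b'0)// lerDl divr_ge0// ltW.
rewrite -[leRHS]powRr1 ?(ltW ab0)// -(mulfV (negbT (gt_eqF r0))) powRrM.
by apply: ge0_ler_powR; rewrite ?nnegrE ?invr_ge0 ?(ltW r0)// powR_ge0.
Qed.

(** * Restrictions, finite mixtures and normalisation of measures *)

(** [mu] is the sum of its restrictions to [D] and to the complement of [D], and [f \_ D] has
    integral 0 for the second one. *)
Lemma ge0_integral_mrestr (d : measure_display) (T : measurableType d)
    (R : realType) (mu : {measure set T -> \bar R}) (D : set T)
    (mD : measurable D) (f : T -> \bar R) :
  (forall x, 0 <= f x) -> measurable_fun setT f ->
  \int[mrestr mu mD]_x f x = \int[mu]_(x in D) f x.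
Proof.
move=> f0 mf; have mDC := measurableC mD.
have fD0 x : 0 <= (f \_ D) x by exact: erestrict_ge0.
have mfD : measurable_fun setT (f \_ D).
  by apply/(measurable_restrictT _ mD); exact: measurable_funTS.
rewrite [RHS]integral_mkcond.
rewrite (eq_measure_integral (measure_add (mrestr mu mD) (mrestr mu mDC))).
  rewrite ge0_integral_measure_add//.
  rewrite [X in _ = _ + X](ge0_negligible_integral mD)//=; last first.
    by rewrite /mrestr setICr measure0.
  rewrite [X in _ = _ + X]integral0_eq ?adde0; last first.
    by move=> x [_ Dx]; rewrite patchE memNset.
  rewrite [LHS](ge0_negligible_integral mDC)//=; last first.
    by rewrite /mrestr setICl measure0.
  rewrite [RHS](ge0_negligible_integral mDC)//=; last first.
    by rewrite /mrestr setICl measure0.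
  by apply: eq_integral => x; rewrite inE => -[_ /contrapT Dx]; rewrite patchE mem_set.
move=> A mA _; rewrite [RHS]measure_addE; change (mu A = mu (A `&` D) + mu (A `&` ~` D)).
rewrite -measureU.
- by rewrite -setIUr setUv setIT.
- exact: measurableI.
- exact: measurableI.
- by rewrite setIACA setICr setI0.
Qed.

(** As [msum] runs over a sequence of measures indexed by [nat], the family is enumerated and
    continued by the zero measure. *)
Lemma mixture_measure (d : measure_display) (T : measurableType d)
    (R : realType) (I : finType) (w : I -> {nonneg R})
    (mu : I -> {measure set T -> \bar R}) :
  exists m : {measure set T -> \bar R},
    (forall A, m A = \sum_i (w i)%:num%:E * mu i A) /\
    (forall f : T -> \bar R, (forall x, 0 <= f x) -> measurable_fun setT f ->
      \int[m]_x f x = \sum_i (w i)%:num%:E * \int[mu i]_x f x).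
Proof.
pose m_ (k : nat) : {measure set T -> \bar R} :=
  if (insub k : option 'I_#|I|) is Some i
  then mscale (w (enum_val i)) (mu (enum_val i)) else mzero.
have mE (i : 'I_#|I|) : m_ i = mscale (w (enum_val i)) (mu (enum_val i)).
  by rewrite /m_ valK.
exists (msum m_ #|I|); split => [A|f f0 mf].
  rewrite /= /msum [RHS](reindex _ (onW_bij _ (enum_val_bij I)))/=.
  by apply: eq_bigr => i _; rewrite mE.
rewrite ge0_integral_measure_sum// [RHS](reindex _ (onW_bij _ (enum_val_bij I)))/=.
by apply: eq_bigr => i _; rewrite mE ge0_integral_mscale.
Qed.

(** Normalising a measure of mass 1 leaves its values unchanged and supplies the probability
    structure; the default [\d_point] is reserved for mass 0 or [+oo]. *)
Lemma measure_probability (d : measure_display) (T : measurableType d)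
    (R : realType) (m : {measure set T -> \bar R}) : m setT = 1 ->
  exists P : probability T R, forall A, P A = m A.
Proof.
move=> m1; exists (mnormalize m \d_point) => A.
by rewrite /= /mnormalize m1 onee_eq0/= -/(fine 1) /= invr1 mule1.
Qed.

(** * Moving the atoms of an empirical measure inside a coupling *)

Section gluing.
Context (d : measure_display) (T : measurableType d) (R : realType).
Context (n : nat) (y y' : 'I_n -> T) (pi : probability (T * T)%type R).
Hypothesis mset1 : forall x : T, measurable [set x].

(* y' may have repetitions: the part of pi above an atom x is shared equally
   between the mult x indices i such that y' i = x. *)
Let mult (x : T) : R := (\sum_(j < n) (y' j \in [set x])%:R)%R.
Let atom (i : 'I_n) : set (T * T) := [set y' i] `*` setT.

Let mult_gt0 i : (0 < mult (y' i))%R.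
Proof.
by rewrite /mult (bigD1 i)//= mem_set// ltr_pwDl//; apply: sumr_ge0.
Qed.

Let matom i : measurable (atom i).
Proof. exact: measurableX. Qed.

(** At a point [z], exactly [mult z.1] indices contribute, each with the inverse weight: the total
    weight is 1 above an atom and 0 elsewhere. With an inequality, the mass of [pi] off the atoms
    need not be examined. *)
Lemma sum_integral_atom_le (g : T * T -> \bar R) :
  (forall z, 0 <= g z) -> measurable_fun setT g ->
  \sum_(i < n) (mult (y' i))^-1%:E * \int[pi]_(z in atom i) g z
    <= \int[pi]_z g z.
Proof.
move=> g0 mg.
have gD0 i z : 0 <= (g \_ (atom i)) z by exact: erestrict_ge0.
have mgD i : measurable_fun setT (g \_ (atom i)).
  by apply/(measurable_restrictT _ (matom i)); exact: measurable_funTS.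
have c0 i : (0 <= (mult (y' i))^-1)%R by rewrite invr_ge0 ltW.
have wg0 i z : 0 <= (mult (y' i))^-1%:E * (g \_ (atom i)) z.
  by rewrite mule_ge0 ?lee_fin.
under eq_bigr do rewrite integral_mkcond -ge0_integralZl_EFin//.
rewrite -ge0_integral_sum//; last by move=> i; exact: measurable_funeM.
apply: ge0_le_integral => //.
- by move=> z _; apply: sume_ge0 => i _; exact: wg0.
- by apply: emeasurable_sum => i; exact: measurable_funeM.
move=> z _.
rewrite (eq_bigr (fun i => ((mult z.1)^-1 * (y' i \in [set z.1])%:R)%:E * g z));
  last first.
  move=> i _; rewrite patchE; have [zi|zi] := boolP (z \in atom i).
    by move: zi; rewrite inE => -[/= -> _]; rewrite mem_set// mulr1.
  rewrite [_ \in _](negbTE _) ?mulr0 ?mul0e ?mule0//.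
  by apply: contra zi; rewrite !inE => yz; split => //=; rewrite yz.
rewrite -ge0_sume_distrl; last first.
  by move=> i _; rewrite lee_fin mulr_ge0// invr_ge0 sumr_ge0.
rewrite sumEFin -mulr_sumr -/(mult z.1) -[leRHS]mul1e lee_wpmul2r// lee_fin.
by have [->|?] := eqVneq (mult z.1) 0%R; rewrite ?mulr0// mulVf.
Qed.

Lemma coupling_atom (eta : {measure set T -> \bar R}) (i : 'I_n) :
  couplings (empirical R y') eta pi -> pi (atom i) = (n%:R^-1 * mult (y' i))%:E.
Proof.
move=> cpl; rewrite (cpl _ (mset1 (y' i))).1 /= /empirical EFinM -sumEFin.
by congr (_ * _); apply: eq_bigr => j _; rewrite diracE.
Qed.

(** [pi'] is the sum over [i] of the share of [pi] above [y' i], carried by [z |-> (y i, z.2)]. Each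
    share has mass 1/n, which gives the first marginal; the second coordinates do not move. *)
Lemma empirical_gluing (eta : {measure set T -> \bar R}) : (0 < n)%N ->
  couplings (empirical R y') eta pi ->
  exists2 pi' : probability (T * T)%type R,
    couplings (empirical R y) eta pi' &
    forall f : T * T -> \bar R, (forall z, 0 <= f z) -> measurable_fun setT f ->
      \int[pi']_z f z =
      \sum_(i < n) (mult (y' i))^-1%:E * \int[pi]_(z in atom i) f (y i, z.2).
Proof.
move=> n0 cpl.
have mphi i : measurable_fun setT (fun z : T * T => (y i, z.2)).
  by apply: measurable_fun_pair => //; exact: measurable_snd.
pose phi i : {mfun (T * T)%type >-> (T * T)%type} :=
  HB.pack (fun z : T * T => (y i, z.2)) (isMeasurableFun.Build _ _ _ _ _ (mphi i)).
have c0 i : (0 <= (mult (y' i))^-1)%R by rewrite invr_ge0 ltW.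
have [m [mE mint]] := mixture_measure (fun i => NngNum (c0 i))
  (fun i => pushforward (mrestr pi (matom i)) (phi i)).
have m1 A : measurable A -> m (A `*` setT) = empirical R y A.
  move=> mA; rewrite mE /empirical ge0_sume_distrr//; apply: eq_bigr => i _ /=.
  rewrite /pushforward /mrestr diracE.
  have [yA|yA] := boolP (y i \in A).
    rewrite (_ : _ `&` _ = atom i) ?(coupling_atom _ cpl) -?EFinM; last first.
      by apply/seteqP; split => z [] //= ? ?; split => //; split => //; exact: set_mem.
    by rewrite mulrCA mulVf ?gt_eqF.
  rewrite (_ : _ `&` _ = set0) ?measure0 ?mule0//.
  by apply/seteqP; split => z // [[]] /= /mem_set; rewrite (negbTE yA).
have mT : m setT = 1 by rewrite -setXTT m1// empirical_setT.
have m2le A : measurable A -> m (setT `*` A) <= pi (setT `*` A).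
  move=> mA; have mTA : measurable ([set: T] `*` A) by exact: measurableX.
  rewrite mE -[X in _ <= pi X]setIT -[leRHS]integral_indic//.
  apply: le_trans (sum_integral_atom_le _ _) => //; last first.
    by apply/measurable_EFinP; exact: measurable_indic.
  apply: lee_sum => i _; rewrite integral_indic//.
have [pi' pi'E] := measure_probability mT.
exists pi'; last first.
  move=> f f0 mf; rewrite (eq_measure_integral m) => [|A _ _]; last exact: pi'E.
  rewrite mint//; apply: eq_bigr => i _; congr (_ * _).
  rewrite ge0_integral_pushforward// preimage_setT ge0_integral_mrestr//.
    by move=> z; exact: f0.
  exact: (measurableT_comp mf (mphi i)).
move=> A mA; split; first by rewrite pi'E m1.
(* m2le bounds both A and its complement, and the total masses agree. *)
rewrite -(cpl A mA).2; apply/eqP; rewrite eq_le pi'E m2le//=.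
have mTA : measurable ([set: T] `*` A) by exact: measurableX.
have TAC : ~` ([set: T] `*` A) = [set: T] `*` ~` A.
  by apply/seteqP; split => [z nA|z [_ nA] [_ /nA]//]; split => // Az; exact: nA.
have := m2le _ (measurableC mA).
rewrite -TAC -pi'E (probability_setC pi)// (probability_setC pi')// pi'E.
have /fineK <- : pi (setT `*` A) \is a fin_num by rewrite fin_num_measure.
have /fineK <- : m (setT `*` A) \is a fin_num by rewrite -pi'E fin_num_measure.
by rewrite !lee_fin lerD2l lerN2.
Qed.

(** Above [y' i] the distance grows by at most [dist (y i) (y' i)], which is constant on the slice,
    so the weighted inequality can be integrated slice by slice. *)
Lemma empirical_cost_le (dist : T -> T -> R) (r t : R)
    (eta : {measure set T -> \bar R}) :
  (forall x1 x2, (0 <= dist x1 x2)%R) ->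
  (forall x1 x2 x3, (dist x1 x3 <= dist x1 x2 + dist x2 x3)%R) ->
  measurable_fun setT (fun z : T * T => dist z.1 z.2) ->
  (1 <= r)%R -> (0 < t < 1)%R -> (0 < n)%N -> couplings (empirical R y') eta pi ->
  exists2 pi' : probability (T * T)%type R,
    couplings (empirical R y) eta pi' &
    \int[pi']_z ((dist z.1 z.2) `^ r)%:E
      <= (t `^ (1 - r))%:E * \int[pi]_z ((dist z.1 z.2) `^ r)%:E
         + ((1 - t) `^ (1 - r)
            * (n%:R^-1 * \sum_(i < n) dist (y i) (y' i) `^ r))%:E.
Proof.
move=> d0 dtri md r1 t01 n0 cpl; have [pi' cpl' pi'E] := empirical_gluing n0 cpl.
exists pi' => //.
have mc : measurable_fun setT (fun z : T * T => ((dist z.1 z.2) `^ r)%:E).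
  by apply/measurable_EFinP; exact: (measurableT_comp (measurable_powR r) md).
have c0 z : 0 <= ((dist z.1 z.2) `^ r)%:E by rewrite lee_fin powR_ge0.
have w0 i : (0 <= (mult (y' i))^-1)%R by rewrite invr_ge0 ltW.
rewrite pi'E//.
set C := (t `^ (1 - r))%R; set C' := ((1 - t) `^ (1 - r))%R.
have C0 : (0 <= C)%R by exact: powR_ge0.
have C'0 : (0 <= C')%R by exact: powR_ge0.
pose dl i := (dist (y i) (y' i) `^ r)%R.
have dl0 i : (0 <= dl i)%R by exact: powR_ge0.
have msnd i : measurable_fun setT (fun z : T * T => ((dist (y i) z.2) `^ r)%:E).
  have mphi : measurable_fun setT (fun z : T * T => (y i, z.2)).
    by apply: measurable_fun_pair => //; exact: measurable_snd.
  exact: (measurableT_comp mc mphi).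
apply: (@le_trans _ _ (\sum_(i < n) (mult (y' i))^-1%:E *
    (C%:E * \int[pi]_(z in atom i) ((dist z.1 z.2) `^ r)%:E
     + (C' * dl i)%:E * pi (atom i)))).
  apply: lee_sum => i _; apply: lee_wpmul2l; first by rewrite lee_fin.
  rewrite -ge0_integralZl_EFin//; last exact: measurable_funTS.
  rewrite -integral_cst// -ge0_integralD//; last 3 first.
  - by move=> z _; rewrite mule_ge0// lee_fin.
  - by apply: measurable_funTS; exact: measurable_funeM.
  - by move=> z _; rewrite lee_fin mulr_ge0.
  apply: ge0_le_integral => //.
  - exact: measurable_funTS (msnd i).
  - apply: measurable_funTS; apply: emeasurable_funD => //.
    exact: measurable_funeM.
  move=> z [/= zi _]; rewrite -EFinM -EFinD lee_fin.
  apply: le_trans (powR_addl_weighted r1 (d0 _ _) (d0 _ _) t01).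
  apply: ge0_ler_powR; rewrite ?nnegrE ?addr_ge0 ?d0//.
    by rewrite (le_trans _ r1).
  by rewrite zi addrC.
(* The slice has mass [mult (y' i) / n]: the multiplicity cancels and each displacement is charged
   1/n. *)
rewrite (eq_bigr (fun i => C%:E * ((mult (y' i))^-1%:E *
    \int[pi]_(z in atom i) ((dist z.1 z.2) `^ r)%:E)
    + (C' * (n%:R^-1 * dl i))%:E)); last first.
  move=> i _; rewrite (coupling_atom _ cpl) ge0_muleDr; last 2 first.
  - by rewrite mule_ge0 ?lee_fin// integral_ge0.
  - by rewrite mule_ge0 ?lee_fin ?mulr_ge0// ltW.
  congr (_ + _); first by rewrite muleCA.
  rewrite -!EFinM; congr (_%:E).
  have := mult_gt0 i; move: (mult _) => m m0.
  rewrite [LHS](_ : _ = m^-1 * m * (C' * (n%:R^-1 * dl i)))%R; last by ring.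
  by rewrite mulVf ?mul1r// gt_eqF.
rewrite big_split/= -ge0_sume_distrr; last first.
  by move=> i _; rewrite mule_ge0 ?lee_fin// integral_ge0.
rewrite sumEFin -!mulr_sumr leeD2r// lee_wpmul2l ?lee_fin//.
exact: sum_integral_atom_le.
Qed.
End gluing.

(** * From single couplings to Wasserstein distances and their means *)

(** The affine map can be inverted, which moves the bound under the infimum. Positivity of [c]
    matters for empty [S], where the infimum is [+oo] but [0 * +oo] would be 0. *)
Lemma ereal_inf_affine_le (R : realType) (S : set (\bar R)) (a : \bar R) (c k : R) :
  (0 < c)%R -> (forall x, S x -> a <= c%:E * x + k%:E) ->
  a <= c%:E * ereal_inf S + k%:E.
Proof.
move=> c0 H; rewrite -leeBlDr// -lee_pdivrMl//.
by apply: le_ereal_inf_tmp => x /H; rewrite lee_pdivrMl// leeBlDr.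
Qed.

Lemma empirical_cst (d : measure_display) (T : measurableType d) (R : realType)
    (n : nat) (x : T) (A : set T) : (0 < n)%N ->
  empirical R (fun _ : 'I_n => x) A = \d_x A.
Proof.
move=> n0; rewrite /empirical diracE sumEFin sumr_const card_ord -EFinM.
by set c := (_ \in _)%:R; rewrite -[(c *+ n)%R]mulr_natl mulKf// pnatr_eq0 -lt0n.
Qed.

Section wasserstein_theory.
Context (d : measure_display) (T : measurableType d) (R : realType).
Context (dist : T -> T -> R) (r : R).
Hypothesis r1 : (1 <= r)%R.

Let r0 : (r != 0)%R. Proof. by rewrite gt_eqF// (lt_le_trans _ r1). Qed.

(** The infimum is nonnegative, so the outer root cancels; estimates can then be made on the cost of
    one coupling at a time. *)
Lemma wasserstein_poweR (mu nu : {measure set T -> \bar R}) :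
  wasserstein dist r mu nu `^ r =
  ereal_inf [set \int[pi]_z ((dist z.1 z.2) `^ r)%:E | pi in couplings mu nu].
Proof.
rewrite /wasserstein -poweRrM mulVf// poweRe1//.
apply: le_ereal_inf_tmp => _ [pi _ <-].
by apply: integral_ge0 => z _; rewrite lee_fin powR_ge0.
Qed.

Hypothesis mset1 : forall x : T, measurable [set x].
Hypothesis dist_ge0 : forall x1 x2, (0 <= dist x1 x2)%R.
Hypothesis dist_triangle :
  forall x1 x2 x3, (dist x1 x3 <= dist x1 x2 + dist x2 x3)%R.
Hypothesis mdist : measurable_fun setT (fun z : T * T => dist z.1 z.2).

Lemma wasserstein_empirical_le (n : nat) (y y' : 'I_n -> T) (t : R)
    (eta : {measure set T -> \bar R}) :
  (0 < t < 1)%R -> (0 < n)%N ->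
  wasserstein dist r (empirical R y) eta `^ r <=
  (t `^ (1 - r))%:E * wasserstein dist r (empirical R y') eta `^ r
  + ((1 - t) `^ (1 - r) * (n%:R^-1 * \sum_(i < n) dist (y i) (y' i) `^ r))%:E.
Proof.
move=> t01 n0; rewrite !wasserstein_poweR.
apply: ereal_inf_affine_le => [|_ [pi cpl <-]].
  by rewrite powR_gt0//; case/andP: t01.
have [pi' cpl' le_pi] :=
  empirical_cost_le y mset1 dist_ge0 dist_triangle mdist r1 t01 n0 cpl.
by apply: le_trans le_pi; apply: ereal_inf_lbound; exists pi'.
Qed.

Definition mean_wasserstein (J : nat) (n : 'I_J -> nat)
    (y : forall j, 'I_(n j) -> T) (eta : {measure set T -> \bar R}) : \bar R :=
  (J%:R^-1)%:E *
  \sum_(j < J) wasserstein dist r (empirical R (y j)) eta `^ r.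

(** This is [D] of the overview: the L^r norm of the displacements for the weights
    [1 / (J * n j)]. *)
Definition sample_dist (J : nat) (n : 'I_J -> nat)
    (y y' : forall j, 'I_(n j) -> T) : R :=
  ((J%:R^-1 * \sum_(j < J) ((n j)%:R^-1 *
    \sum_(i < n j) dist (y j i) (y' j i) `^ r)) `^ r^-1)%R.

Lemma sample_distC (J : nat) (n : 'I_J -> nat)
    (y y' : forall j, 'I_(n j) -> T) : (forall x1 x2, dist x1 x2 = dist x2 x1) ->
  sample_dist y y' = sample_dist y' y.
Proof.
move=> dC; rewrite /sample_dist; congr (powR (_ * _) _); apply: eq_bigr => j _.
by congr (_ * _)%R; apply: eq_bigr => i _; rewrite dC.
Qed.

(** For one [t] common to all samples, the weighted bounds average to a bound of the same form
    between the means; eliminating [t] afterwards gives the inequality of Minkowski type for the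
    r-th roots. *)
Lemma mean_wasserstein_le (J : nat) (n : 'I_J -> nat)
    (y y' : forall j, 'I_(n j) -> T) (eta : {measure set T -> \bar R}) :
  (forall j, 0 < n j)%N ->
  mean_wasserstein y eta `^ r^-1 <=
  mean_wasserstein y' eta `^ r^-1 + (sample_dist y y')%:E.
Proof.
move=> n0; pose mean (z : forall j, 'I_(n j) -> T) := mean_wasserstein z eta.
rewrite -/(mean y) -/(mean y').
have mean0 z : 0 <= mean z.
  by rewrite mule_ge0 ?lee_fin// sume_ge0// => j _; exact: poweR_ge0.
have ri0 : (r^-1 != 0)%R by rewrite invr_eq0.
pose D := (J%:R^-1 * \sum_(j < J) ((n j)%:R^-1 *
    \sum_(i < n j) dist (y j i) (y' j i) `^ r))%R.
have D0 : (0 <= D)%R.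
  rewrite mulr_ge0// sumr_ge0// => j _; rewrite mulr_ge0// sumr_ge0// => i _.
  exact: powR_ge0.
have H t : (0 < t < 1)%R ->
    mean y <= (t `^ (1 - r))%:E * mean y' + ((1 - t) `^ (1 - r) * D)%:E.
  move=> t01; rewrite /mean /mean_wasserstein muleCA.
  rewrite [X in _ + X](_ : _ = (J%:R^-1)%:E * (\sum_(j < J) ((1 - t) `^ (1 - r) *
      ((n j)%:R^-1 * \sum_(i < n j) dist (y j i) (y' j i) `^ r))%:E)); last first.
    by rewrite sumEFin -EFinM -mulr_sumr mulrCA.
  rewrite -ge0_muleDr; last 2 first.
  - by rewrite mule_ge0 ?lee_fin ?powR_ge0// sume_ge0// => j _; exact: poweR_ge0.
  - apply: sume_ge0 => j _; rewrite lee_fin mulr_ge0 ?powR_ge0// mulr_ge0//.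
    by apply: sumr_ge0 => i _; exact: powR_ge0.
  rewrite lee_wpmul2l ?lee_fin// ge0_sume_distrr; last first.
    by move=> j _; exact: poweR_ge0.
  rewrite -big_split/=; apply: lee_sum => j _.
  exact: wasserstein_empirical_le.
have [my'|my'] := eqVneq (mean y') +oo.
  by rewrite my' poweRyr// addye// leey.
have fin' : mean y' \is a fin_num by rewrite ge0_fin_numE// ltey.
have fin : mean y \is a fin_num.
  rewrite ge0_fin_numE//.
  (* Any [t] would do here: a finite bound on [mean y] is all that is wanted, to pass to real
     numbers. *)
  have /H/le_lt_trans : (0 < (2^-1 : R) < 1)%R by apply/andP; split; lra.
  by apply; rewrite -(fineK fin') -EFinM -EFinD ltry.
have mean_powR : mean y' = ((fine (mean y') `^ r^-1) `^ r)%R%:E.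
  by rewrite -powRrM mulVf// powRr1 ?fine_ge0// fineK.
have D_powR : D = ((D `^ r^-1) `^ r)%R by rewrite -powRrM mulVf// powRr1.
rewrite /sample_dist -/D -(fineK fin) -{1}(fineK fin') !poweR_EFin -EFinD lee_fin.
apply: powR_weighted_addl => //; rewrite ?powR_ge0 ?fine_ge0//.
move=> t /H; move: (fineK fin) => <-.
by rewrite {1}mean_powR {1}D_powR -EFinM -EFinD lee_fin.
Qed.

End wasserstein_theory.

(** * The Euclidean distance and the Borel sigma-algebra of row vectors *)

(** The same device with exponent 2: the weighted bound is summed over the coordinates before [t] is
    eliminated. *)
Lemma sqrt_sum_sqrD (R : realType) (n : nat) (a b : 'I_n -> R) :
  (Num.sqrt (\sum_(i < n) (a i + b i) ^+ 2) <=
   Num.sqrt (\sum_(i < n) a i ^+ 2) + Num.sqrt (\sum_(i < n) b i ^+ 2))%R.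
Proof.
have S0 (c : 'I_n -> R) : (0 <= \sum_(i < n) c i ^+ 2)%R.
  by apply: sumr_ge0 => i _; exact: sqr_ge0.
rewrite -powR12_sqrt//; apply: powR_weighted_addl; rewrite ?ler1n ?sqrtr_ge0// => t t01.
rewrite !(powR_mulrn 2) ?sqrtr_ge0// !sqr_sqrtr// !mulr_sumr -big_split/=.
apply: ler_sum => i _.
have := powR_addl_weighted (ler1n R 2) (normr_ge0 (a i)) (normr_ge0 (b i)) t01.
rewrite !(powR_mulrn 2) ?addr_ge0// !real_normK ?num_real//; apply: le_trans.
by rewrite -real_normK ?num_real// lerXn2r ?nnegrE ?addr_ge0// ler_normD.
Qed.

Section borel_row_vectors.
Context (R : realType) (d : nat).
Local Notation T := (borel_rV R d).

Lemma measurable_coord (i : 'I_d) :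
  measurable_fun setT (fun x : T => (x : 'rV[R]_d) 0%R i).
Proof.
apply: (measurability _ (RGenOpens.measurableE R)).
move=> _ [_ [a [b ->]] <-]; rewrite setTI; apply: sub_sigma_algebra.
have := @coord_continuous R 1 d 0%R i; move/continuousP; apply.
exact: interval_open.
Qed.

Lemma measurable_set1_rV (x : T) : measurable [set x].
Proof.
have -> : [set x] = \bigcap_(i in [set: 'I_d])
    (fun y : T => (y : 'rV[R]_d) 0%R i) @^-1` [set (x : 'rV[R]_d) 0%R i].
  apply/seteqP; split => [_ -> //|y xy].
  by apply/rowP => i; exact: xy.
apply: fin_bigcap_measurable => // i _; rewrite -[X in measurable X]setTI.
exact: measurable_coord.
Qed.

Lemma euclidean_dist_ge0 (x y : T) : (0 <= euclidean_dist x y)%R.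
Proof. exact: sqrtr_ge0. Qed.

Lemma euclidean_distxx (x : T) : euclidean_dist x x = 0%R.
Proof.
rewrite /euclidean_dist subrr /euclidean_norm big1 ?sqrtr0// => i _.
by rewrite mxE expr0n.
Qed.

Lemma euclidean_distC (x y : T) : euclidean_dist x y = euclidean_dist y x.
Proof.
congr (Num.sqrt _); apply: eq_bigr => i _.
by rewrite !mxE -sqrrN opprB.
Qed.

Lemma euclidean_dist_triangle (x y z : T) :
  (euclidean_dist x z <= euclidean_dist x y + euclidean_dist y z)%R.
Proof.
apply: le_trans (sqrt_sum_sqrD _ _).
rewrite le_eqVlt; apply/orP; left; apply/eqP; congr (Num.sqrt _).
by apply: eq_bigr => i _; rewrite !mxE addrA subrK.
Qed.

(** The pair carries the product sigma-algebra, so the distance is assembled from measurable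
    coordinates, its square root being the power 1/2. *)
Lemma measurable_euclidean_dist :
  measurable_fun setT (fun z : T * T => euclidean_dist z.1 z.2).
Proof.
rewrite (_ : (fun _ => _) = (fun z : T * T => ((\sum_(i < d)
    ((z.1 : 'rV[R]_d) 0%R i - (z.2 : 'rV[R]_d) 0%R i) ^+ 2) `^ 2^-1)%R)).
  apply: (measurableT_comp (measurable_powR 2^-1)).
  apply: measurable_sum => i; apply: measurable_funX; apply: measurable_funB.
    exact: (measurableT_comp (measurable_coord i) measurable_fst).
  exact: (measurableT_comp (measurable_coord i) measurable_snd).
apply/funext => z; rewrite powR12_sqrt; last first.
  by apply: sumr_ge0 => i _; exact: sqr_ge0.
by congr (Num.sqrt _); apply: eq_bigr => i _; rewrite !mxE.
Qed.

Lemma measurable_euclidean_norm :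
  measurable_fun setT (fun x : T => euclidean_norm (x : 'rV[R]_d)).
Proof.
rewrite (_ : (fun _ => _) = (fun x : T => euclidean_dist x (0%R : 'rV[R]_d))).
  have mx0 : measurable_fun setT (fun x : T => (x, (0%R : 'rV[R]_d) : T)).
    exact: measurable_fun_pair.
  exact: (measurableT_comp measurable_euclidean_dist mx0).
by apply/funext => x; rewrite /euclidean_dist subr0.
Qed.

Lemma rat_rV_dense (x : T) (e : R) : (0 < e)%R ->
  exists q : 'rV[rat]_d, (euclidean_dist x (map_mx ratr q : 'rV[R]_d) <= e)%R.
Proof.
(* The divisor [d.+1] is nonzero even for [d = 0], and [d <= d.+1 ^ 2] is enough for the sum of [d]
   squares. *)
move=> e0; pose dl := (e / d.+1%:R)%R.
have dl0 : (0 < dl)%R by rewrite divr_gt0.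
have /choice[q qE] (i : 'I_d) : exists q : rat,
    ratr q \in `](x : 'rV[R]_d) 0%R i - dl, (x : 'rV[R]_d) 0%R i + dl[%R.
  by apply: rat_in_itvoo; rewrite ltrBlDr -addrA ltrDl addr_gt0.
exists (\row_i q i); rewrite -[leRHS](ger0_norm (ltW e0)) -sqrtr_sqr ler_wsqrtr//.
apply: (@le_trans _ _ (\sum_(i < d) dl ^+ 2)%R).
  apply: ler_sum => i _; rewrite !mxE -real_normK ?num_real//.
  rewrite lerXn2r ?nnegrE ?(ltW dl0)//.
  by have := qE i; rewrite in_itv/= => /andP[? ?]; rewrite ler_norml; apply/andP; split; lra.
rewrite sumr_const card_ord /dl expr_div_n -[leLHS]mulr_natl mulrCA -[leRHS]mulr1.
rewrite ler_wpM2l ?sqr_ge0// ler_pdivrMr ?exprn_gt0// mul1r -natrX ler_nat.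
by rewrite (leq_trans (leqnSn d))// -mulnn leq_pmulr.
Qed.

End borel_row_vectors.

(** * The variation of a sample: Lipschitz bound, finiteness, measurability *)

Section sample_variation.
Context (R : realType) (d J : nat) (n : 'I_J -> nat) (r : R).
Hypotheses (r1 : (1 <= r)%R) (J0 : (0 < J)%N) (n0 : forall j, (0 < n j)%N).
Local Notation T := (borel_rV R d).
Local Notation sample := (forall j, 'I_(n j) -> T).
Local Notation D := (sample_dist (@euclidean_dist R d) r).

Definition sample_variation (y : sample) : \bar R :=
  wasserstein_variation r (fun j => empirical R (y j)).

Lemma sample_variation_ge0 (y : sample) : 0 <= sample_variation y.
Proof. by apply: le_ereal_inf_tmp => _ [eta _ <-]; exact: poweR_ge0. Qed.

Lemma sample_variation_le (y y' : sample) :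
  sample_variation y <= sample_variation y' + (D y y')%:E.
Proof.
rewrite -leeBlDr//; apply: le_ereal_inf_tmp => _ [eta meta <-].
rewrite leeBlDr//; apply: le_trans; last first.
  apply: (mean_wasserstein_le r1 (@measurable_set1_rV R d)
    (@euclidean_dist_ge0 R d) (@euclidean_dist_triangle R d)
    (@measurable_euclidean_dist R d) y y' eta n0).
by apply: ereal_inf_lbound; exists eta.
Qed.

(** The Dirac mass at the origin serves as [eta], coupled at no cost by [\d_(o, o)]. This is the
    reference sample from which every variation is seen to be finite. *)
Lemma sample_variation_cst0 :
  sample_variation (fun _ _ => (0%R : 'rV[R]_d) : T) = 0.
Proof.
have r0 : (r != 0)%R by rewrite gt_eqF// (lt_le_trans _ r1).
pose o : T := (0%R : 'rV[R]_d).
apply/eqP; rewrite eq_le sample_variation_ge0 andbT.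
apply: ge_ereal_inf; exists 0 => //; exists (\d_o : probability T R).
  rewrite /= /finite_moment.
  rewrite (eq_measure_integral \d_o)// integral_dirac// ?diracT ?mul1e ?ltry//.
  apply/measurable_EFinP; apply: (measurableT_comp (measurable_powR r)).
  exact: measurable_euclidean_norm.
rewrite big1 ?mule0 ?poweR0r ?invr_eq0// => j _.
rewrite wasserstein_poweR//.
apply/eqP; rewrite eq_le; apply/andP; split; last first.
  apply: le_ereal_inf_tmp => _ [pi _ <-].
  by apply: integral_ge0 => z _; rewrite lee_fin powR_ge0.
apply: ge_ereal_inf; exists 0 => //.
exists (\d_(o, o) : probability (T * T)%type R).
  move=> A mA; split.
    rewrite /= empirical_cst// !diracE in_setX in_setT andbT//.
  by rewrite /= !diracE in_setX in_setT.
rewrite (eq_measure_integral \d_(o, o))// integral_dirac// ?diracT ?mul1e.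
  by rewrite /= euclidean_distxx powR0.
apply/measurable_EFinP; apply: (measurableT_comp (measurable_powR r)).
exact: measurable_euclidean_dist.
Qed.

Lemma sample_variation_fin_num (y : sample) : sample_variation y \is a fin_num.
Proof.
rewrite ge0_fin_numE ?sample_variation_ge0//.
apply: le_lt_trans (sample_variation_le y (fun _ _ => (0%R : 'rV[R]_d) : T)) _.
by rewrite sample_variation_cst0 add0e ltry.
Qed.

Lemma rat_sample_dense (y : sample) (e : R) : (0 < e)%R ->
  exists q : {ffun {j : 'I_J & 'I_(n j)} -> 'rV[rat]_d},
    (D y (fun j i => map_mx ratr (q (existT _ j i)) : 'rV[R]_d) <= e)%R.
Proof.
move=> e0.
have r0 : (0 < r)%R by exact: lt_le_trans r1.
have /choice[q qE] (k : {j : 'I_J & 'I_(n j)}) :=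
  rat_rV_dense (y (tag k) (tagged k)) e0.
exists (finfun q).
(* The weights in [D] sum to 1, so displacements of at most [e] give a value of at most [e]. *)
have le_er : (J%:R^-1 * \sum_(j < J) (n j)%:R^-1 * \sum_(i < n j) e `^ r = e `^ r)%R.
  have mean_cst (k : nat) (c : R) : (0 < k)%N -> (k%:R^-1 * \sum_(i < k) c = c)%R.
    by move=> k0; rewrite sumr_const card_ord -[(c *+ k)%R]mulr_natl mulKf// pnatr_eq0 -lt0n.
  by under eq_bigr do rewrite mean_cst//; rewrite mean_cst.
rewrite -[leRHS]powRr1 ?(ltW e0)// -(mulfV (negbT (gt_eqF r0))) powRrM.
rewrite -[X in (_ <= X `^ _)%R]le_er.
have s0 (F : forall j, 'I_(n j) -> R) : (forall j i, 0 <= F j i)%R ->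
    (0 <= J%:R^-1 * \sum_(j < J) (n j)%:R^-1 * \sum_(i < n j) F j i)%R.
  move=> F0; rewrite mulr_ge0// sumr_ge0// => j _.
  by rewrite mulr_ge0// sumr_ge0.
apply: ge0_ler_powR; rewrite ?nnegrE ?s0 ?invr_ge0 ?(ltW r0)//.
- by move=> *; exact: powR_ge0.
- by move=> *; exact: powR_ge0.
rewrite ler_wpM2l//; apply: ler_sum => j _; rewrite ler_wpM2l//; apply: ler_sum => i _.
apply: ge0_ler_powR; rewrite ?nnegrE ?euclidean_dist_ge0 ?(ltW r0) ?(ltW e0)//.
by rewrite ffunE; exact: (qE (existT (fun j => 'I_(n j)) j i)).
Qed.

Context (disp : measure_display) (Omega : measurableType disp).
Context (Y : forall j, 'I_(n j) -> Omega -> T).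
Hypothesis mY : forall j i, measurable_fun setT (@Y j i).

Lemma measurable_sample_dist (y : sample) :
  measurable_fun setT (fun w => D (fun j i => @Y j i w) y).
Proof.
apply: (measurableT_comp (measurable_powR r^-1)).
apply: measurable_funM => //; apply: measurable_sum => j.
apply: measurable_funM => //; apply: measurable_sum => i.
apply: (measurableT_comp (measurable_powR r)).
have mYy : measurable_fun setT (fun w => (@Y j i w, y j i)).
  exact: measurable_fun_pair.
exact: (measurableT_comp (@measurable_euclidean_dist R d) mYy).
Qed.

(* Going through rational samples q, as the infimum over q of the functions
   y |-> V_r(q) + D(y, q), avoids comparing the Borel sigma-algebra of
   (R^d)^N with the product one. *)
Lemma measurable_sample_variation :
  measurable_fun setT (fun w => sample_variation (fun j i => @Y j i w)).
Proof.
pose Q : countType := {ffun {j : 'I_J & 'I_(n j)} -> 'rV[rat]_d}.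
pose pt (q : Q) : sample := fun j i => map_mx ratr (q (existT _ j i)).
(* Numbers that encode no rational sample get [+oo], which is neutral for the infimum. *)
pose h (k : nat) w : \bar R := if (unpickle k : option Q) is Some q
  then sample_variation (pt q) + (D (fun j i => @Y j i w) (pt q))%:E else +oo.
have mh k : measurable_fun setT (h k).
  rewrite /h; case: (unpickle k) => // q.
  apply: emeasurable_funD => //; apply/measurable_EFinP.
  exact: measurable_sample_dist.
rewrite (_ : (fun _ => _) = (fun w => einfs (h ^~ w) 0%N)).
  exact: measurable_fun_einfs.
apply/funext => w; set y := fun j i => @Y j i w.
apply/eqP; rewrite eq_le; apply/andP; split.
  apply: le_ereal_inf_tmp => _ [k _ <-]; rewrite /h.
  by case: (unpickle k) => [q|]; [exact: sample_variation_le|exact: leey].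
apply/lee_addgt0Pr => e e0.
(* [D] is paid twice: once as the added term of [h], once for replacing [y] by [q] in the
   variation. *)
have e20 : (0 < e / 2)%R by rewrite divr_gt0.
have [q qE] := rat_sample_dense y e20.
apply: ge_ereal_inf; exists (h (pickle (q : Q)) w).
  by exists (pickle (q : Q)).
rewrite /h pickleK -/y.
apply: (@le_trans _ _ (sample_variation y + (D (pt q) y)%:E + (D y (pt q))%:E)).
  by rewrite leeD2r// sample_variation_le.
rewrite -addeA leeD2l// -EFinD lee_fin.
rewrite (sample_distC r _ _ (@euclidean_distC R d)) [e in leRHS]splitr.
by rewrite lerD.
Qed.

End sample_variation.

(** * Finite independent families and the uniqueness of their joint law *)

(** Each new index multiplies the sample space by a factor [S] and reads that coordinate; [uniq s]
    prevents it from overwriting an earlier variable. Indices outside [s] get some measurable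
    map. *)
Lemma exists_product_seq (d : measure_display) (S : measurableType d)
    (R : realType) (I : eqType) (m : I -> probability S R) (s : seq I) : uniq s ->
  exists (d' : measure_display) (Omega : measurableType d')
    (P : probability Omega R) (X : I -> Omega -> S),
    (forall i, measurable_fun setT (X i)) /\
    forall B : I -> set S, (forall i, measurable (B i)) ->
      P (\bigcap_(i in [set` s]) X i @^-1` B i) = \prod_(i <- s) m i (B i).
Proof.
elim: s => [_|i s IH /= /andP[iNs /IH]].
  exists _, S, (\d_point : probability S R), (fun _ => id); split => // B mB.
  by rewrite big_nil set_nil bigcap_set0 probability_setT.
move=> [d' [W [P [X [mX PX]]]]].
exists _, (S * W)%type, (m i \x P : probability _ R).
exists (fun k z => if k == i then z.1 else X k z.2); split => [k|B mB].
  case: (k == i); first exact: measurable_fst.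
  exact: (measurableT_comp (mX k) measurable_snd).
rewrite big_cons -PX// -product_measure1E//; last first.
  apply: fin_bigcap_measurable => [|k _]; first exact: finite_seq.
  by rewrite -[X in measurable X]setTI; exact: mX.
congr (product_measure1 _ _ _); apply/seteqP; split => [z Xz|z [Bz1 Xz] k].
  split => [|k ks]; first by have := Xz i; rewrite /= mem_head eqxx; exact.
  have := Xz k; rewrite /= in_cons orbC ks /=.
  by rewrite (negbTE (memPn iNs _ ks)); exact.
rewrite /= in_cons; have [-> _|ki /= ks] := eqVneq k i; first exact: Bz1.
exact: Xz.
Qed.

Lemma exists_product (d : measure_display) (S : measurableType d)
    (R : realType) (I : finType) (m : I -> probability S R) :
  exists (d' : measure_display) (Omega : measurableType d')
    (P : probability Omega R) (X : I -> Omega -> S),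
    [/\ forall i, measurable_fun setT (X i),
      forall i (A : set S), measurable A -> P (X i @^-1` A) = m i A &
      forall B : I -> set S, (forall i, measurable (B i)) ->
        P (\bigcap_i X i @^-1` B i) = \prod_i m i (B i)].
Proof.
have [d' [W [P [X [mX PX]]]]] := exists_product_seq m (index_enum_uniq I).
have PXT (B : I -> set S) : (forall i, measurable (B i)) ->
    P (\bigcap_i X i @^-1` B i) = \prod_i m i (B i).
  move=> mB; rewrite -PX//; congr (P _); congr (\bigcap_(i in _) _).
  by apply/seteqP; split => // i _; exact: mem_index_enum.
exists d', W, P, X; split => // i A mA.
pose B k := if k == i then A else setT.
have mB k : measurable (B k) by rewrite /B; case: ifP.
have -> : X i @^-1` A = \bigcap_k X k @^-1` B k.
  apply/seteqP; split => [w Aw k _|w /(_ i Logic.I)]; rewrite /= /B.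
    by case: eqVneq => // ->.
  by rewrite eqxx.
rewrite PXT// (bigD1 i)//= /B eqxx big1 ?mule1// => k /negbTE ->.
exact: probability_setT.
Qed.

Section product_law.
Context (d : measure_display) (T : measurableType d) (R : realType) (I : finType).

(** Generators of the product sigma-algebra on [I -> T]. Prescribing every side makes them stable
    under intersection, as uniqueness of measures requires. *)
Definition boxes : set (set (I -> T)) :=
  [set E | exists B : I -> set T, (forall i, measurable (B i)) /\
     E = \bigcap_i (fun f => f i) @^-1` B i].

Lemma measurable_eval (i : I) :
  measurable_fun setT (fun f : g_sigma_algebraType boxes => (f : I -> T) i).
Proof.
move=> _ A mA; rewrite setTI; apply: sub_sigma_algebra.
exists (fun k => if k == i then A else setT); split => [k|]; first by case: ifP.
apply/seteqP; split => [f Af k _|f /(_ i Logic.I)]; rewrite /=.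
  by case: eqVneq => // ->.
by rewrite eqxx.
Qed.

Lemma measurable_sample (d' : measure_display) (Omega : measurableType d')
    (X : I -> Omega -> T) : (forall i, measurable_fun setT (X i)) ->
  measurable_fun setT (fun w => (X ^~ w) : g_sigma_algebraType boxes).
Proof.
move=> mX; apply: (@measurability _ _ Omega (g_sigma_algebraType boxes) setT
  (fun w => X ^~ w) boxes) => // _ [_ [B [mB ->]] <-].
rewrite setTI preimage_bigcap; apply: fin_bigcap_measurable => // i _.
by rewrite -[X in measurable X]setTI; exact: mX.
Qed.

(** A pi-system argument on the image laws on [I -> T], the common space to which families defined
    on different probability spaces are transported. *)
Lemma sample_law_unique (d1 d2 : measure_display)
    (O1 : measurableType d1) (O2 : measurableType d2)
    (P1 : probability O1 R) (P2 : probability O2 R)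
    (X1 : I -> O1 -> T) (X2 : I -> O2 -> T) :
  (forall i, measurable_fun setT (X1 i)) ->
  (forall i, measurable_fun setT (X2 i)) ->
  (forall B : I -> set T, (forall i, measurable (B i)) ->
    P1 (\bigcap_i X1 i @^-1` B i) = P2 (\bigcap_i X2 i @^-1` B i)) ->
  forall E : set (g_sigma_algebraType boxes), measurable E ->
    P1 ((fun w => X1 ^~ w) @^-1` E) = P2 ((fun w => X2 ^~ w) @^-1` E).
Proof.
move=> mX1 mX2 PX E mE.
pose S1 : {mfun O1 >-> g_sigma_algebraType boxes} := HB.pack
  (fun w => (X1 ^~ w) : g_sigma_algebraType boxes)
  (isMeasurableFun.Build _ _ _ _ _ (measurable_sample mX1)).
pose S2 : {mfun O2 >-> g_sigma_algebraType boxes} := HB.pack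
  (fun w => (X2 ^~ w) : g_sigma_algebraType boxes)
  (isMeasurableFun.Build _ _ _ _ _ (measurable_sample mX2)).
change (distribution P1 S1 E = distribution P2 S2 E).
apply: (@measure_unique _ R (g_sigma_algebraType boxes) boxes (fun _ => setT)) mE => //.
- move=> _ _ [B [mB ->]] [B' [mB' ->]].
  exists (fun i => B i `&` B' i); split; first by move=> i; exact: measurableI.
  by rewrite -bigcapI.
- move=> _; exists (fun _ => setT); split => //.
  by apply/seteqP; split.
- by rewrite bigcup_const.
- by move=> _ [B [mB ->]]; exact: (PX B mB).
- by move=> k; rewrite ltey_eq fin_num_measure.
Qed.

End product_law.

(** * Averages over the samples and the coupling of the two laws *)

(** If all infima are finite, elements within [e] of them raise the mean by at most [e]. If one is
    [+oo], so is the right-hand side, the others being nonnegative. *)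
Lemma le_mean_ereal_inf (R : realType) (J : nat) (S : 'I_J -> set (\bar R))
    (a : \bar R) : (0 < J)%N ->
  (forall j x, S j x -> 0 <= x) ->
  (forall x : 'I_J -> \bar R, (forall j, S j (x j)) ->
    a <= (J%:R^-1)%:E * \sum_(j < J) x j) ->
  a <= (J%:R^-1)%:E * \sum_(j < J) ereal_inf (S j).
Proof.
move=> J0 S0 H.
have JR0 : (0 < J%:R^-1 :> R)%R by rewrite invr_gt0 ltr0n.
have I0 j : 0 <= ereal_inf (S j) by apply: le_ereal_inf_tmp => x; exact: S0.
have [[j Ij]|/forallNP Iny] := pselect (exists j, ereal_inf (S j) = +oo).
  rewrite (bigD1 j)//= Ij addye; last first.
    by rewrite gt_eqF// (lt_le_trans ltNy0)// sume_ge0.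
  by rewrite gt0_muley ?lte_fin// leey.
have Ifin j : ereal_inf (S j) \is a fin_num.
  by rewrite ge0_fin_numE// ltey; exact/eqP.
apply/lee_addgt0Pr => e e0.
have /choice[x xE] j : exists x, S j x /\ x <= ereal_inf (S j) + e%:E.
  have [x Sx /ltW xI] := lb_ereal_inf_adherent e0 (Ifin j).
  by exists x.
apply: (le_trans (H x (fun j => (xE j).1))).
apply: (@le_trans _ _ ((J%:R^-1)%:E * \sum_(j < J) (ereal_inf (S j) + e%:E))).
  rewrite lee_wpmul2l ?lee_fin ?(ltW JR0)//.
  by apply: lee_sum => j _; exact: (xE j).2.
rewrite big_split/= ge0_muleDr ?sume_ge0//; last first.
  by move=> j _; rewrite lee_fin ltW.
rewrite leeD2l// sumEFin sumr_const card_ord -EFinM lee_fin.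
by rewrite -[(e *+ J)%R]mulr_natl mulKf// pnatr_eq0 -lt0n.
Qed.

Lemma sample_mean_integral (d : measure_display) (T : measurableType d)
    (R : realType) (d' : measure_display) (Omega : measurableType d')
    (P : probability Omega R) (J : nat) (n : 'I_J -> nat)
    (c : forall j, 'I_(n j) -> Omega -> R) (C : 'I_J -> \bar R) :
  (forall j, 0 < n j)%N ->
  (forall j i w, 0 <= c j i w)%R ->
  (forall j i, measurable_fun setT (c j i)) ->
  (forall j i, \int[P]_w (c j i w)%:E = C j) ->
  \int[P]_w (J%:R^-1 * \sum_(j < J) ((n j)%:R^-1 * \sum_(i < n j) c j i w))%:E =
  (J%:R^-1)%:E * \sum_(j < J) C j.
Proof.
move=> n0 c0 mc cC.
have mean0 j w : (0 <= (n j)%:R^-1 * \sum_(i < n j) c j i w)%R.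
  by rewrite mulr_ge0// sumr_ge0.
have ms j : measurable_fun setT (fun w => \sum_(i < n j) c j i w)%R.
  by apply: measurable_sum => i.
under eq_integral do rewrite EFinM -sumEFin.
rewrite ge0_integralZl_EFin//; last 2 first.
- by move=> w _; rewrite sume_ge0// => j _; rewrite lee_fin.
- by apply: emeasurable_sum => j; apply/measurable_EFinP; exact: measurable_funM.
congr (_ * _); rewrite ge0_integral_sum//; last 2 first.
- by move=> j; apply/measurable_EFinP; exact: measurable_funM.
- by move=> j w _; rewrite lee_fin.
apply: eq_bigr => j _.
under eq_integral do rewrite EFinM -sumEFin.
rewrite ge0_integralZl_EFin//; last 2 first.
- by move=> w _; rewrite sume_ge0// => i _; rewrite lee_fin.
- by apply: emeasurable_sum => i; exact/measurable_EFinP.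
rewrite ge0_integral_sum//; last 2 first.
- by move=> i; exact/measurable_EFinP.
- by move=> i w _; rewrite lee_fin.
under eq_bigr do rewrite cC -[C j]mul1e.
rewrite -ge0_sume_distrl// sumEFin sumr_const card_ord muleA -EFinM.
rewrite mulVf ?mul1e//.
by rewrite pnatr_eq0 -lt0n.
Qed.

Lemma independent_samples_box (d d' : measure_display)
    (Omega : measurableType d) (T : measurableType d') (R : realType)
    (P : probability Omega R) (J : nat) (n : 'I_J -> nat)
    (nu : 'I_J -> probability T R)
    (Y : forall j : 'I_J, 'I_(n j) -> {RV P >-> T})
    (B : {j : 'I_J & 'I_(n j)} -> set T) :
  independent_samples nu Y -> (forall k, measurable (B k)) ->
  P (\bigcap_k (Y (tag k) (tagged k) : Omega -> T) @^-1` B k) =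
  \prod_k nu (tag k) (B k).
Proof.
move=> [Ylaw Yind] mB; have := Yind [set: _]%SET B mB.
rewrite (_ : [set` [set: _]%SET] = setT); last first.
  by apply/seteqP; split => // k _; rewrite /= finset.in_setT.
move=> ->; apply: eq_big => [k|k _]; first by rewrite finset.in_setT.
exact: Ylaw.
Qed.

Lemma sample_variation_lipschitz (R : realType) (d J : nat) (n : 'I_J -> nat)
    (r : R) (y y' : forall j, 'I_(n j) -> borel_rV R d) :
  (1 <= r)%R -> (0 < J)%N -> (forall j, 0 < n j)%N ->
  (`|fine (sample_variation r y) - fine (sample_variation r y')|
    <= sample_dist (@euclidean_dist R d) r y y')%R.
Proof.
move=> r1 J0 n0.
have fin z : @sample_variation R d J n r z \is a fin_num.
  exact: sample_variation_fin_num.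
have H (z z' : forall j, 'I_(n j) -> borel_rV R d) :
    (fine (sample_variation r z) - fine (sample_variation r z')
    <= sample_dist (@euclidean_dist R d) r z z')%R.
  by rewrite lerBlDl -lee_fin EFinD !fineK//; exact: sample_variation_le.
rewrite ler_norml H andbT lerNl opprB.
by rewrite (sample_distC r y y' (@euclidean_distC R d)).
Qed.

Theorem theorem2 (R : realType) (d J : nat) (hd : (0 < d)%N) (hJ : (0 < J)%N)
  (r : R) (hr : (1 <= r)%R)
  (nu nu' : 'I_J -> probability (borel_rV R d) R)
  (hnu : forall j, finite_moment r (nu j))
  (hnu' : forall j, finite_moment r (nu' j))
  (n : 'I_J -> nat) (hn : forall j, (0 < n j)%N)
  (disp disp' : measure_display)
  (Omega : measurableType disp) (Omega' : measurableType disp')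
  (P : probability Omega R) (P' : probability Omega' R)
  (Y : forall j : 'I_J, 'I_(n j) -> {RV P >-> borel_rV R d})
  (Y' : forall j : 'I_J, 'I_(n j) -> {RV P' >-> borel_rV R d})
  (hY : independent_samples nu Y) (hY' : independent_samples nu' Y') :
  exists (V : {RV P >-> measurableTypeR R}) (V' : {RV P' >-> measurableTypeR R}),
    [/\ forall w, (V w : R)%:E =
          wasserstein_variation r
            (fun j => empirical R (fun i : 'I_(n j) => Y j i w)),
        forall w, (V' w : R)%:E =
          wasserstein_variation r
            (fun j => empirical R (fun i : 'I_(n j) => Y' j i w)) &
        wasserstein (@abs_dist R) r (distribution P V) (distribution P' V') `^ r
        <= (J%:R^-1)%:E *
           \sum_(j < J) wasserstein (@euclidean_dist R d) r (nu j) (nu' j) `^ r].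
Proof.
pose I : finType := {j : 'I_J & 'I_(n j)}.
(* All points are listed as one family over [I]; [fine] loses nothing since the variation is
   finite. *)
pose G (f : I -> borel_rV R d) : R :=
  fine (sample_variation r (fun j i => f (existT (fun j => 'I_(n j)) j i))).
have mGX (d1 : measure_display) (O1 : measurableType d1) (X : I -> O1 -> borel_rV R d) :
    (forall k, measurable_fun setT (X k)) -> measurable_fun setT (fun w => G (X ^~ w)).
  move=> mX; apply: measurableT_comp; first exact: fine_measurable.
  exact: (measurable_sample_variation hr hJ hn (fun j i => mX (existT _ j i))).
have mYk (k : I) :
    measurable_fun setT (Y (tag k) (tagged k) : Omega -> borel_rV R d) by [].
have mYk' (k : I) :
    measurable_fun setT (Y' (tag k) (tagged k) : Omega' -> borel_rV R d) by [].
pose V : {RV P >-> measurableTypeR R} := HB.pack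
  (fun w => G (fun k => Y (tag k) (tagged k) w))
  (isMeasurableFun.Build _ _ Omega (measurableTypeR R) _ (mGX _ _ _ mYk)).
pose V' : {RV P' >-> measurableTypeR R} := HB.pack
  (fun w => G (fun k => Y' (tag k) (tagged k) w))
  (isMeasurableFun.Build _ _ Omega' (measurableTypeR R) _ (mGX _ _ _ mYk')).
exists V, V'; split=> [w|w|].
- by rewrite fineK//; exact: sample_variation_fin_num.
- by rewrite fineK//; exact: sample_variation_fin_num.
rewrite wasserstein_poweR//.
under [in leRHS]eq_bigr do rewrite wasserstein_poweR//.
(* From here on [c j] is the cost of one arbitrary coupling for each [j]. *)
apply: le_mean_ereal_inf => // [j x [pi _ <-]|c /= cE].
  by apply: integral_ge0 => z _; rewrite lee_fin powR_ge0.
have /choice[pi piE] j : exists pi : probability (borel_rV R d * borel_rV R d)%type R,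
    couplings (nu j) (nu' j) pi /\
    \int[pi]_z ((euclidean_dist z.1 z.2) `^ r)%:E = c j.
  by have [pi cpl <-] := cE j; exists pi.
have [d0 [W [Q [X [mX QX QB]]]]] := exists_product (fun k : I => pi (tag k)).
pose A k w := (X k w).1; pose B k w := (X k w).2.
have mA k : measurable_fun setT (A k) := measurableT_comp measurable_fst (mX k).
have mB k : measurable_fun setT (B k) := measurableT_comp measurable_snd (mX k).
(* The evaluations are themselves a measurable family on [I -> T], and [G] is its variation. *)
have mG : measurable_fun setT
    (G : g_sigma_algebraType (@boxes _ (borel_rV R d) I) -> R).
  exact: (mGX _ _ _ (@measurable_eval _ (borel_rV R d) I)).
have law (d1 d2 : measure_display) (O1 : measurableType d1)
    (O2 : measurableType d2) (P1 : probability O1 R) (P2 : probability O2 R)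
    (X1 : I -> O1 -> borel_rV R d) (X2 : I -> O2 -> borel_rV R d)
    (C : set (measurableTypeR R)) :
    (forall k, measurable_fun setT (X1 k)) ->
    (forall k, measurable_fun setT (X2 k)) ->
    (forall B : I -> set (borel_rV R d), (forall k, measurable (B k)) ->
      P1 (\bigcap_k X1 k @^-1` B k) = P2 (\bigcap_k X2 k @^-1` B k)) ->
    measurable C ->
    P1 ((fun w => G (X1 ^~ w)) @^-1` C) = P2 ((fun w => G (X2 ^~ w)) @^-1` C).
  move=> mX1 mX2 PX mC.
  have mGC := mG measurableT C mC; rewrite setTI in mGC.
  exact: (sample_law_unique mX1 mX2 PX mGC).
(* A box for [A] is a box for the pairs with full second sides, whose probabilities are given by the
   first marginals [nu]; [lawB] is symmetric. *)
have lawA C : measurable C ->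
    Q ((fun w => G (A ^~ w)) @^-1` C) = distribution P V C.
  move=> mC; apply: law => // E mE.
  rewrite (independent_samples_box hY mE).
  rewrite [LHS](_ : _ = Q (\bigcap_k X k @^-1` (E k `*` setT))); last first.
    congr (Q _); apply: eq_bigcapr => k _.
    by apply/seteqP; split => w //= [].
  rewrite QB; last by move=> k; exact: measurableX.
  by apply: eq_bigr => k _; exact: ((piE (tag k)).1 _ (mE k)).1.
have lawB C : measurable C ->
    Q ((fun w => G (B ^~ w)) @^-1` C) = distribution P' V' C.
  move=> mC; apply: law => // E mE.
  rewrite (independent_samples_box hY' mE).
  rewrite [LHS](_ : _ = Q (\bigcap_k X k @^-1` (setT `*` E k))); last first.
    congr (Q _); apply: eq_bigcapr => k _.
    by apply/seteqP; split => w //= [].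
  rewrite QB; last by move=> k; exact: measurableX.
  by apply: eq_bigr => k _; exact: ((piE (tag k)).1 _ (mE k)).2.
have mZ : measurable_fun setT (fun w => (G (A ^~ w), G (B ^~ w))).
  exact: (measurable_fun_pair (mGX _ _ _ mA) (mGX _ _ _ mB)).
pose Z : {mfun W >-> (measurableTypeR R * measurableTypeR R)%type} :=
  HB.pack (fun w => (G (A ^~ w), G (B ^~ w)))
    (isMeasurableFun.Build _ _ W (measurableTypeR R * measurableTypeR R)%type _ mZ).
apply: ge_ereal_inf.
exists (\int[distribution Q Z]_z ((abs_dist z.1 z.2) `^ r)%:E).
  exists (distribution Q Z) => // C mC; split.
    transitivity (Q ((fun w => G (A ^~ w)) @^-1` C)); last exact: lawA.
    by congr (Q _); apply/seteqP; split => w //= [].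
  transitivity (Q ((fun w => G (B ^~ w)) @^-1` C)); last exact: lawB.
  by congr (Q _); apply/seteqP; split => w //= [].
have mabs : measurable_fun setT
    (fun z : measurableTypeR R * measurableTypeR R => ((abs_dist z.1 z.2) `^ r)%:E).
  apply/measurable_EFinP; apply: (measurableT_comp (measurable_powR r)).
  apply: measurableT_comp => //; apply: measurable_funB.
    exact: measurable_fst.
  exact: measurable_snd.
rewrite ge0_integral_distribution//; last by move=> z; rewrite lee_fin powR_ge0.
pose e j i w := (euclidean_dist (A (existT (fun j => 'I_(n j)) j i) w)
                   (B (existT (fun j => 'I_(n j)) j i) w) `^ r)%R.
have mc : measurable_fun setT (fun z : borel_rV R d * borel_rV R d =>
    (euclidean_dist z.1 z.2 `^ r)%R).
  exact: (measurableT_comp (measurable_powR r) (@measurable_euclidean_dist R d)).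
have me j i : measurable_fun setT (e j i) := measurableT_comp mc (mX _).
(* The right-hand side becomes the expectation of the r-th power of [D], so a pointwise comparison
   remains. *)
rewrite -(@sample_mean_integral _ _ R _ W Q J n e c)//; last 2 first.
- by move=> j i w; exact: powR_ge0.
- move=> j i; pose k : I := existT (fun j => 'I_(n j)) j i.
  pose Xk : {mfun W >-> (borel_rV R d * borel_rV R d)%type} :=
    HB.pack (X k) (isMeasurableFun.Build _ _ W
      (borel_rV R d * borel_rV R d)%type _ (mX k)).
  rewrite -(piE j).2 [RHS](eq_measure_integral (distribution Q Xk)); last first.
    by move=> E mE _; exact: (esym (QX k E mE)).
  rewrite ge0_integral_distribution//; first exact/measurable_EFinP.
  by move=> z; rewrite lee_fin powR_ge0.
apply: ge0_le_integral => //.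
- by move=> w _; rewrite lee_fin powR_ge0.
- exact: (measurableT_comp mabs mZ).
- apply/measurable_EFinP; apply: measurable_funM => //; apply: measurable_sum => j.
  by apply: measurable_funM => //; apply: measurable_sum => i; exact: me.
move=> w _; rewrite lee_fin.
have r0 : (0 < r)%R by exact: lt_le_trans hr.
have lip := sample_variation_lipschitz
  (fun j i => A (existT (fun j => 'I_(n j)) j i) w)
  (fun j i => B (existT (fun j => 'I_(n j)) j i) w) hr hJ hn.
apply: le_trans (ge0_ler_powR (ltW r0) _ _ lip) _; rewrite ?nnegrE ?powR_ge0//.
rewrite /sample_dist -powRrM mulVf ?gt_eqF// powRr1//.
rewrite mulr_ge0// sumr_ge0// => j _; rewrite mulr_ge0// sumr_ge0// => i _.
exact: powR_ge0.
Qed.
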